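(* Let $G=K\ltimes\mathbb{R}^n$, where $K$ is a separable unimodular locally compact group of type I. Suppose that $G$ satisfies the following Heisenberg uncertainty inequality: there is a constant $C_0$ such that for all $h\in L^2(G)$ and all $a,b\ge1$, $$\|h\|_2^{\left(\frac1a+\frac1b\right)}\le C_0\left(\int_{K\times\mathbb{R}^n}\|x\|^{2a}|h(k,x)|^2\,dx\,dk\right)^{\frac1{2a}}\left(\int_{\widehat{\mathbb{R}^n}/G}\int_{\widehat{K_\gamma}}\|\gamma\|^{2b}\,\|\pi_{\gamma,\sigma}(h)\|_{\mathrm{HS}}^2\,d\mu_\gamma(\sigma)\,d\overline{\mu}_{\mathbb{R}^n}(\overline{\gamma})\right)^{\frac1{2b}}.$$ Then there is a constant $C$ such that for every window function $\psi$ (a non-zero $\psi\in L^2(G)$), every $f\in L^2(G)$ and all $a,b\ge1$, $$\|\psi\|_2^{\frac1b}\,\|f\|_2^{\left(\frac1a+\frac1b\right)}\le C\left(\int_{K\times\mathbb{R}^n}\|x\|^{2a}|f(k,x)|^2\,dx\,dk\right)^{\frac1{2a}}\left(\int_{K\times\mathbb{R}^n}\int_{\widehat{\mathbb{R}^n}/G}\int_{\widehat{K_\gamma}}\|\gamma\|^{2b}\,\|G_\psi f(u,t,\gamma,\sigma)\|_{\mathrm{HS}}^2\,d\mu_\gamma(\sigma)\,d\overline{\mu}_{\mathbb{R}^n}(\overline{\gamma})\,du\,dt\right)^{\frac1{2b}}.$$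
   Context: Elements of $G=K\ltimes\mathbb{R}^n$ are written $(k,x)$ with $k\in K$, $x\in\mathbb{R}^n$. Integration over $G$ is with respect to $dk\,dx$, where $dk$ is a Haar measure on $K$ and $dx$ is Lebesgue measure on $\mathbb{R}^n$; $\|\cdot\|_2$ is the norm of $L^2(G)$. $\|\cdot\|$ is the Euclidean norm on $\mathbb{R}^n$ and on $\widehat{\mathbb{R}^n}\cong\mathbb{R}^n$. For $\gamma\in\widehat{\mathbb{R}^n}$ (unitary characters of $\mathbb{R}^n$), $G_\gamma$ and $K_\gamma$ are the stabilizers of $\gamma$ in $G$ and $K$, so $G_\gamma=K_\gamma\ltimes\mathbb{R}^n$. $\widehat{K_\gamma}$ is the set of equivalence classes of irreducible unitary representations of $K_\gamma$. For $\sigma\in\widehat{K_\gamma}$, $\gamma\otimes\sigma$ is the representation $kx\mapsto\gamma(x)\sigma(k)$ ($k\in K_\gamma$, $x\in\mathbb{R}^n$) of $G_\gamma$, and $\pi_{\gamma,\sigma}=\operatorname{ind}_{G_\gamma}^{G}(\gamma\otimes\sigma)$ is the corresponding irreducible induced representation of $G$. For $h\in L^1(G)\cap L^2(G)$, $\pi_{\gamma,\sigma}(h)=\int_G h(k,x)\,\pi_{\gamma,\sigma}(k,x)^*\,dx\,dk$. $\widehat{\mathbb{R}^n}/G$ is the space of $G$-orbits $\overline{\gamma}$ in $\widehat{\mathbb{R}^n}$ (inside integrals, $\gamma$ is a representative of $\overline{\gamma}$, the same in all formulas). $\overline{\mu}_{\mathbb{R}^n}$ on $\widehat{\mathbb{R}^n}/G$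 and $\mu_\gamma$ on $\widehat{K_\gamma}$ are the measures for which the Plancherel formula of $G$ holds (a standing fact of the setting): for all $h\in L^2(G)$, $$\int_G|h(g)|^2\,dg=\int_{\widehat{\mathbb{R}^n}/G}\int_{\widehat{K_\gamma}}\|\pi_{\gamma,\sigma}(h)\|_{\mathrm{HS}}^2\,d\mu_\gamma(\sigma)\,d\overline{\mu}_{\mathbb{R}^n}(\overline{\gamma}),$$ where $\|\cdot\|_{\mathrm{HS}}$ is the Hilbert–Schmidt norm and $\pi_{\gamma,\sigma}(h)$ for general $h\in L^2(G)$ is defined (almost everywhere) by the $L^2$-extension of the Fourier transform. Gabor transform: for a window function $\psi$ and $f\in L^2(G)$, put, for $(u,t)\in G$, $$f^\psi_{u,t}(k,x)=f(k,x)\,\overline{\psi(ku^{-1},x-t)},$$ which belongs to $L^2(G)$ for almost every $(u,t)$. The continuous Gabor transform of $f$ with respect to $\psi$ is $$G_\psi f(u,t,\gamma,\sigma)=\int_G f^\psi_{u,t}(k,x)\,\pi_{\gamma,\sigma}(k,x)^*\,dx\,dk=\pi_{\gamma,\sigma}(f^\psi_{u,t}).$$ The constant $C$ does not depend on $f$ or $\psi$. Integrals may be infinite, in which case the corresponding right-hand side is read as $+\infty$. *)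

(* Defs.v *)
From HB Require Import structures.
From mathcomp Require Import all_boot all_order all_algebra sesquilinear.
From mathcomp Require Import complex.
From mathcomp Require Import all_classical all_reals all_analysis.

Set Implicit Arguments.
Unset Strict Implicit.
Unset Printing Implicit Defensive.

Import Order.TTheory GRing.Theory Num.Theory.
Import numFieldTopology.Exports numFieldNormedType.Exports.

Local Open Scope classical_set_scope.
Local Open Scope ring_scope.
Local Open Scope complex_scope.

HB.mixin Record isTopologicalGroup G of Topological G & Group G := {
  mulg_continuous : continuous (fun p : G * G => (p.1 * p.2)%g);
  invg_continuous : continuous (fun x : G => (x^-1)%g)
}.
#[short(type="topologicalGroupType")]
HB.structure Definition TopologicalGroup :=
  {G of PointedTopological G & Group G & isTopologicalGroup G}.

Definition borel (T : ptopologicalType) := g_sigma_algebraType (@open T).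

(* In a second countable locally compact Hausdorff group every Borel measure
   that is finite on compact sets is regular, so regularity is not required. *)
Definition left_haar (R : realType) (K : topologicalGroupType)
    (mu : set (borel K) -> \bar R) :=
  [/\ forall (k : K) (A : set (borel K)), measurable A ->
        mu [set (k * x)%g | x in (A : set K)] = mu A,
      forall A : set K, compact A -> (mu A < +oo)%E
    & mu setT != 0%E].

Definition unimodular (R : realType) (K : topologicalGroupType) :=
  forall mu : {measure set (borel K) -> \bar R}, left_haar mu ->
  forall (k : K) (A : set (borel K)), measurable A ->
    mu [set (x * k)%g | x in (A : set K)] = mu A.

Definition dnorm (R : realType) (V : lmodType R[i])
    (f : {dot V for @Num.conj R[i]}) (v : V) : R :=
  Num.sqrt (complex.Re (f v v)).

Record hilbert (R : realType) := Hilbert {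
  hsort :> lmodType R[i];
  dotp : {dot hsort for @Num.conj R[i]};
  hilbert_complete : forall u : nat -> hsort,
    (forall e : R, 0 < e -> exists N : nat, forall p q : nat,
      (N <= p)%N -> (N <= q)%N -> dnorm dotp (u p - u q) < e) ->
    exists l : hsort, dnorm dotp (u n - l) @[n --> \oo] --> (0 : R) }.

Section Operators.
Variable R : realType.
Implicit Types H : hilbert R.

Definition hnorm H (v : H) : R := dnorm (dotp H) v.

Definition bounded_op H (A : H -> H) :=
  linear A /\ exists M : R, forall v, hnorm (A v) <= M * hnorm v.

Definition isometric H1 H2 (T : H1 -> H2) :=
  linear T /\ forall u v, dotp H2 (T u) (T v) = dotp H1 u v.

Definition closed_subspace H (W : set H) :=
  [/\ W 0, forall (a : R[i]) u v, W u -> W v -> W (a *: u + v)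
    & forall v, (forall e : R, 0 < e -> exists2 w, W w & hnorm (v - w) < e) ->
        W v].

Definition orthonormal_basis H (B : set H) :=
  (forall e e', B e -> B e' -> dotp H e e' = (e == e')%:R) /\
  (forall v, (forall e, B e -> dotp H v e = 0) -> v = 0).

Definition onb H : set H := xget set0 [set B | @orthonormal_basis H B].

Definition hs_norm2 H (A : H -> H) : \bar R :=
  \esum_(e in @onb H) ((hnorm (A e)) ^+ 2)%:E.

End Operators.

Section Representations.
Variables (R : realType) (G : topologicalGroupType) (S : set G).

(* Unitary representations of the subgroup S; the values of rho outside S are
   irrelevant. Surjectivity of [rho g] follows from the homomorphism laws. *)
Definition unitary_rep (H : hilbert R) (rho : G -> H -> H) :=
  [/\ forall g, S g -> isometric (rho g),
      forall v, rho 1%g v = v,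
      forall g h v, S g -> S h -> rho (g * h)%g v = rho g (rho h v)
    & forall v g, S g ->
        hnorm (rho x v - rho g v) @[x --> within S (nbhs g)] --> (0 : R)].

Record urep := URep {
  urep_space : hilbert R;
  urep_op :> G -> urep_space -> urep_space;
  urepP : unitary_rep urep_op }.

Definition intertwines (r1 r2 : urep) (T : urep_space r1 -> urep_space r2) :=
  forall g v, S g -> T (r1 g v) = r2 g (T v).

Definition unitarily_equiv (r1 r2 : urep) :=
  exists T : urep_space r1 -> urep_space r2,
    [/\ isometric T, range T = setT & intertwines T].

Definition irreducible (r : urep) :=
  (exists v : urep_space r, v != 0) /\
  forall W : set (urep_space r), closed_subspace W ->
    (forall g v, S g -> W v -> W (r g v)) -> W = [set 0] \/ W = setT.

Definition commutant (r : urep) : set (urep_space r -> urep_space r) :=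
  [set A | bounded_op A /\ intertwines A].
Definition primary (r : urep) :=
  forall A, @commutant r A ->
    (forall B, @commutant r B -> forall v, A (B v) = B (A v)) ->
    exists c : R[i], forall v, A v = c *: v.

(* r is a Hilbert direct sum of copies of s: V is the set of the embeddings
   of the copies. *)
Definition multiple_of (r s : urep) :=
  exists V : set (urep_space s -> urep_space r),
    [/\ forall T, V T -> isometric T /\ intertwines T,
        forall T T', V T -> V T' -> T <> T' ->
          forall u v, dotp _ (T u) (T' v) = 0
      & forall w, (forall T, V T -> forall u, dotp _ w (T u) = 0) -> w = 0].

Definition irr_on (H : hilbert R) : set (G -> H -> H) :=
  [set rho | exists p : unitary_rep rho, irreducible (URep p)].

(* The set of equivalence classes of irreducible representations, given by
   a complete set of representatives (a type of sets of representations would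
   live in too large a universe to carry a measurable structure). *)
Record unitary_dual := UnitaryDual {
  udual :> pointedType;
  udual_rep : udual -> urep;
  udual_irr : forall s, irreducible (udual_rep s);
  udual_complete : forall r, irreducible r ->
    exists s, unitarily_equiv r (udual_rep s);
  udual_inj : forall s t, unitarily_equiv (udual_rep s) (udual_rep t) ->
    s = t }.

(* The Mackey Borel structure: the quotient of the structure on the space of
   the irreducible representations on H which is generated by the maps
   rho |-> <rho g u, v>. *)
Definition coefficient_sets (H : hilbert R) : set (set (G -> H -> H)) :=
  [set E | exists g u v (B : set R), [/\ S g, measurable B &
     E = @irr_on H `&`
           [set rho | B (complex.Re (dotp H (rho g u) v))] \/
     E = @irr_on H `&`
           [set rho | B (complex.Im (dotp H (rho g u) v))]]].

Definition mackey_sets (D : unitary_dual) : set (set D) :=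
  [set E | forall H : hilbert R,
     <<s @irr_on H, @coefficient_sets H >>
       [set rho | exists (p : unitary_rep rho) (s : D),
          E s /\ unitarily_equiv (URep p) (udual_rep s)]].

Definition mackey_borel (D : unitary_dual) :=
  g_sigma_algebraType (@mackey_sets D).

End Representations.

Definition type_I (R : realType) (G : topologicalGroupType) :=
  forall r : urep R [set: G], primary r ->
    exists2 s : urep R [set: G], irreducible s & multiple_of r s.

(* The quotient of T by the partition into the classes [cl x]. *)
Definition quot (T : Type) (cl : T -> set T) : Type :=
  {c : set T | exists x, c = cl x}.

Section Quotient.
Variables (T : ptopologicalType) (cl : T -> set T).

Definition to_quot (x : T) : quot cl := exist _ (cl x) (ex_intro _ x erefl).

Definition quot_repr (c : quot cl) : T := sval (cid (svalP c)).

HB.instance Definition _ := gen_eqMixin (quot cl).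
HB.instance Definition _ := gen_choiceMixin (quot cl).
HB.instance Definition _ := isPointed.Build (quot cl) (to_quot point).

Definition quot_borel := g_sigma_algebraType
  [set E : set (quot cl) | measurable (to_quot @^-1` E : set (borel T))].

End Quotient.

Local Notation cnorm := ComplexField.Normc.normc.

Definition cintegral d (T : measurableType d) (R : realType)
    (mu : {measure set T -> \bar R}) (f : T -> R[i]) : R[i] :=
  (\int[mu]_x complex.Re (f x)) +i* (\int[mu]_x complex.Im (f x)).

Section Induction.
Variables (R : realType) (G : topologicalGroupType) (S : set G).

Definition left_coset (g : G) : set G := [set (g * s)%g | s in S].

Definition coset_act (g : G) (c : quot left_coset) : quot left_coset :=
  to_quot left_coset (g * quot_repr c)%g.

(* lam g is the Radon-Nikodym derivative of the translate A |-> mu (g^-1 A) of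
   mu; its existence for all g is the quasi-invariance of mu. *)
Definition quasi_invariant (mu : {measure set (quot_borel left_coset) -> \bar R})
    (lam : G -> quot left_coset -> R) :=
  forall g, [/\ forall c, 0 <= lam g c,
    measurable_fun [set: quot_borel left_coset]
      (lam g : quot_borel left_coset -> R)
  & forall A : set (quot_borel left_coset), measurable A ->
      mu (coset_act g @^-1` A) = (\int[mu]_(c in A) (lam g c)%:E)%E].

Definition mackey_space (H : hilbert R) (tau : G -> H -> H)
    (mu : {measure set (quot_borel left_coset) -> \bar R}) : set (G -> H) :=
  [set xi | [/\ forall v,
      measurable_fun [set: borel G]
        ((fun g => complex.Re (dotp H (xi g) v)) : borel G -> R) /\
      measurable_fun [set: borel G]
        ((fun g => complex.Im (dotp H (xi g) v)) : borel G -> R),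
    forall g s, S s -> xi (g * s)%g = tau (s^-1)%g (xi g)
  & (\int[mu]_c (hnorm (xi (quot_repr c)) ^+ 2)%:E < +oo)%E]].

(* P is (a realization of) the representation of G induced from the
   representation tau of S: Phi identifies the space of P with the quotient of
   the Mackey space by its null functions. *)
Definition induced (H : hilbert R) (tau : G -> H -> H) (P : urep R [set: G]) :=
  exists (mu : {sigma_finite_measure set (quot_borel left_coset) -> \bar R})
         (lam : G -> quot left_coset -> R) (Phi : (G -> H) -> urep_space P),
  let X := mackey_space tau mu in
  [/\ mu setT != 0%E,
      quasi_invariant mu lam,
      (forall (a : R[i]) xi eta, X xi -> X eta ->
         Phi (fun g => a *: xi g + eta g) = a *: Phi xi + Phi eta),
      (forall w, exists2 xi, X xi & Phi xi = w) /\
      (forall xi eta, X xi -> X eta -> dotp _ (Phi xi) (Phi eta) =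
         cintegral mu (fun c => dotp H (xi (quot_repr c)) (eta (quot_repr c))))
    & forall g xi, X xi -> P g (Phi xi) =
        Phi (fun x => (Num.sqrt (lam g (to_quot left_coset x)))%:C *:
                        xi (g^-1 * x)%g)].

End Induction.

Record automorphism_action (R : realType) (n : nat) (K : topologicalGroupType) :=
  AutomorphismAction {
  act :> K -> 'rV[R]_n -> 'rV[R]_n;
  act1 : forall x, act 1%g x = x;
  actM : forall k l x, act (k * l)%g x = act k (act l x);
  actD : forall k x y, act k (x + y) = act k x + act k y;
  act_continuous : continuous (fun p : K * 'rV[R]_n => act p.1 p.2) }.

Definition sdprod (R : realType) (n : nat) (K : topologicalGroupType)
  (a : automorphism_action R n K) : Type := (K * 'rV[R]_n)%type.

Section SemidirectProduct.
Variables (R : realType) (n : nat) (K : topologicalGroupType).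
Variable a : automorphism_action R n K.
Local Notation G := (sdprod a).

Definition sd_one : G := (1%g, 0).
Definition sd_mul (g h : G) : G := ((g.1 * h.1)%g, g.2 + a g.1 h.2).
Definition sd_inv (g : G) : G := ((g.1^-1)%g, - a (g.1^-1)%g g.2).

Lemma act0 k : a k 0 = 0.
Proof. by apply: (addrI (a k 0)); rewrite -actD !addr0. Qed.

Lemma actN k x : a k (- x) = - a k x.
Proof. by apply: (addrI (a k x)); rewrite -actD !subrr act0. Qed.

Lemma sd_mulA : associative sd_mul.
Proof.
by move=> g h l; rewrite /sd_mul/= mulgA actD actM addrA.
Qed.

Lemma sd_mul1 : left_id sd_one sd_mul.
Proof. by case=> k x; rewrite /sd_mul/= mul1g act1 add0r. Qed.

Lemma sd_mulr1 : right_id sd_one sd_mul.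
Proof. by case=> k x; rewrite /sd_mul/= mulg1 act0 addr0. Qed.

Lemma sd_mulV : left_inverse sd_one sd_inv sd_mul.
Proof. by case=> k x; rewrite /sd_mul/= mulVg addNr. Qed.

Lemma sd_mulrV : right_inverse sd_one sd_inv sd_mul.
Proof.
by case=> k x; rewrite /sd_mul/= mulgV actN -actM mulgV act1 subrr.
Qed.

HB.instance Definition _ := Pointed.copy G (K * 'rV[R]_n)%type.
HB.instance Definition _ := Topological.copy G (K * 'rV[R]_n)%type.
HB.instance Definition _ :=
  isGroup.Build G sd_mulA sd_mul1 sd_mulr1 sd_mulV sd_mulrV.

Lemma sd_mul_continuous : continuous (fun p : G * G => (p.1 * p.2)%g).
Proof.
move=> -[[k x] [l y]].
have c11 : (q : G * G).1.1 @[q --> ((k, x), (l, y))] --> k.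
  exact: (cvg_comp (fun q : G * G => q.1) fst (G := nbhs (k, x))
    cvg_fst cvg_fst).
have c12 : (q : G * G).1.2 @[q --> ((k, x), (l, y))] --> x.
  exact: (cvg_comp (fun q : G * G => q.1) snd (G := nbhs (k, x))
    cvg_fst cvg_snd).
have c21 : (q : G * G).2.1 @[q --> ((k, x), (l, y))] --> l.
  exact: (cvg_comp (fun q : G * G => q.2) fst (G := nbhs (l, y))
    cvg_snd cvg_fst).
have c22 : (q : G * G).2.2 @[q --> ((k, x), (l, y))] --> y.
  exact: (cvg_comp (fun q : G * G => q.2) snd (G := nbhs (l, y))
    cvg_snd cvg_snd).
apply: (@cvg_pair _ _ _ _ (nbhs (k * l)%g) (nbhs (x + a k y)) _ _ _
    (fun q : G * G => (q.1.1 * q.2.1)%g)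
    (fun q : G * G => q.1.2 + a q.1.1 q.2.2)).
- apply: (@continuous2_cvg _ _ _ _ _ _ _ _ (fun u v : K => (u * v)%g)) c11 c21.
  exact: (@mulg_continuous K (k, l)).
- apply: cvgD => //; apply: (@continuous2_cvg _ _ _ _ _ _ _ _ a) c11 c22.
  exact: (@act_continuous _ _ _ a (k, y)).
Qed.

Lemma sd_inv_continuous : continuous (fun x : G => (x^-1)%g).
Proof.
move=> -[k x].
have cV : ((q : G).1^-1)%g @[q --> (k, x)] --> (k^-1)%g.
  exact: (cvg_comp (fun q : G => q.1) (fun l : K => l^-1)%g (G := nbhs k)
    cvg_fst (@invg_continuous K k)).
apply: (@cvg_pair _ _ _ _ (nbhs (k^-1)%g) (nbhs (- a (k^-1)%g x)) _ _ _
  (fun q : G => (q.1^-1)%g) (fun q : G => - a (q.1^-1)%g q.2)) => //.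
apply: cvgN; apply: (@continuous2_cvg _ _ _ _ _ _ _ _ a) cV cvg_snd.
exact: (@act_continuous _ _ _ a ((k^-1)%g, x)).
Qed.

HB.instance Definition _ :=
  isTopologicalGroup.Build G sd_mul_continuous sd_inv_continuous.

End SemidirectProduct.

Section DualSpace.
Variables (R : realType) (n : nat) (K : topologicalGroupType).
Variable a : automorphism_action R n K.
Local Notation Rn := 'rV[R]_n.

Definition lebesgue_Rn (lam : set (borel Rn) -> \bar R) :=
  forall u v : Rn, (forall i, u 0 i <= v 0 i) ->
    lam [set x : Rn | forall i, u 0 i < x 0 i <= v 0 i] =
      (\prod_i (v 0 i - u 0 i))%:E.

(* The norm of the normed module 'rV[R]_n is the sup norm. *)
Definition euclid_norm (x : Rn) : R := Num.sqrt (\sum_i x 0 i ^+ 2).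

(* The character of R^n with parameter gamma. *)
Definition chi (gamma x : Rn) : R[i] :=
  let t := 2 * pi * (\sum_i gamma 0 i * x 0 i) in (cos t +i* sin t)%C.

(* The normal subgroup R^n acts trivially on the characters, so that the
   stabilizers and the orbits in G are determined by the action of K. *)
Definition dual_act (k : K) (f : Rn -> R[i]) : Rn -> R[i] :=
  fun x => f (a (k^-1)%g x).

Definition stabK (gamma : Rn) : set K :=
  [set k | dual_act k (chi gamma) = chi gamma].

Definition stabG (gamma : Rn) : set (sdprod a) := [set g | stabK gamma g.1].

Definition orbit (gamma : Rn) : set Rn :=
  [set gamma' | exists k, chi gamma' = dual_act k (chi gamma)].

Record fourier_data := FourierData {
  dualK : forall gamma, unitary_dual R (stabK gamma);
  ind : forall gamma, dualK gamma -> urep R [set: sdprod a];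
  indP : forall gamma (s : dualK gamma),
    @induced R (sdprod a) (stabG gamma) (urep_space (udual_rep s))
      (fun g v => chi gamma g.2 *: udual_rep s g.1 v) (ind s);
  orbit_repr : quot orbit -> Rn;
  orbit_reprP : forall o, sval o (orbit_repr o);
  mu_orbit : {measure set (quot_borel orbit) -> \bar R};
  mu_dual : forall gamma, {measure set (mackey_borel (dualK gamma)) -> \bar R}
}.

End DualSpace.

Section Fourier.
Variables (R : realType) (n : nat) (K : topologicalGroupType).
Local Notation Rn := 'rV[R]_n.
Variables (muK : {sigma_finite_measure set (borel K) -> \bar R})
          (lam : {sigma_finite_measure set (borel Rn) -> \bar R}).
Local Notation muG := (muK \x lam)%E.
Implicit Types h f psi : K * Rn -> R[i].

Definition L_norm (p : R) h : \bar R :=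
  'N[muG]_p%:E[(fun g => (cnorm (h g))%:E)].

Definition in_L (p : R) : set (K * Rn -> R[i]) :=
  [set h | [/\ measurable_fun [set: borel K * borel Rn]
                 (fun g : borel K * borel Rn => complex.Re (h g)),
               measurable_fun [set: borel K * borel Rn]
                 (fun g : borel K * borel Rn => complex.Im (h g))
             & (L_norm p h < +oo)%E]].

Definition spatial_moment (r : R) h : \bar R :=
  \int[muG]_g
    (euclid_norm g.2 `^ r * cnorm (h g) ^+ 2)%:E.

Definition gabor_slice psi f (ut : K * Rn) : K * Rn -> R[i] :=
  fun g => f g * (psi ((g.1 * ut.1^-1)%g, g.2 - ut.2))^*.

Variables (a : automorphism_action R n K) (D : fourier_data a).

Definition operator_field := forall (o : quot (orbit a))
  (s : dualK D (orbit_repr D o)), urep_space (ind s) -> urep_space (ind s).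
Implicit Types F : operator_field.

Definition plancherel_integral (w : quot (orbit a) -> R) F : \bar R :=
  \int[mu_orbit D]_o \int[mu_dual D (orbit_repr D o)]_s
    ((w o)%:E * hs_norm2 (F o s))%E.

(* The weak integral of h(g) pi(g)^* for pi = pi_{gamma,sigma}; note that
   <pi(g)^* u, v> = <u, pi(g) v>. *)
Definition fourier_L1 h : operator_field := fun o s =>
  xget (fun=> 0) [set A | bounded_op A /\
    forall u v, dotp _ (A u) v =
      cintegral muG (fun g => h g * dotp _ u (ind s g v))].

(* The integral of a non-measurable function is a lower integral; the
   pointwise almost everywhere convergence ensures that F is determined
   almost everywhere. *)
Definition fourier_ext h F := exists hh : nat -> K * Rn -> R[i],
  [/\ forall j, in_L 1 (hh j) /\ in_L 2 (hh j),
      L_norm 2 (fun g => hh j g - h g) @[j --> \oo] --> 0%E,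
      forall o s, bounded_op (F o s),
      {ae mu_orbit D, forall o, {ae mu_dual D (orbit_repr D o), forall s,
         hs_norm2 (fun v => @fourier_L1 (hh j) o s v - F o s v)
           @[j --> \oo] --> 0%E}}
    & plancherel_integral (fun=> 1)
        (fun o s v => @fourier_L1 (hh j) o s v - F o s v) @[j --> \oo] --> 0%E].

Definition fourier h : operator_field :=
  if `[< in_L 1 h /\ in_L 2 h >] then fourier_L1 h
  else xget (fourier_L1 h) (fourier_ext h).

Definition plancherel := forall h, in_L 2 h ->
  (\int[muG]_g (cnorm (h g) ^+ 2)%:E)%E =
  plancherel_integral (fun=> 1) (fourier h).

Definition frequency_moment (r : R) F : \bar R :=
  plancherel_integral (fun o => euclid_norm (orbit_repr D o) `^ r) F.

Definition gabor psi f (ut : K * Rn) : operator_field :=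
  fourier (gabor_slice psi f ut).

End Fourier.

(* C * I1^p * I2^q, read as +oo as soon as one of I1 and I2 is infinite. *)
Definition moment_product (R : realType) (C : R) (I1 : \bar R) (p : R)
    (I2 : \bar R) (q : R) : \bar R :=
  if (I1 == +oo%E) || (I2 == +oo%E) then +oo%E
  else (C%:E * I1 `^ p * I2 `^ q)%E.

Arguments fourier {R n K} muK lam {a} D h.
Arguments plancherel {R n K} muK lam {a} D.
Arguments frequency_moment {R n K a} D r F.
Arguments gabor {R n K} muK lam {a} D psi f ut.

(* Main.v *)
Require Import Defs.
From HB Require Import structures.
From mathcomp Require Import all_boot all_order all_algebra complex.
From mathcomp Require Import all_classical all_reals all_analysis.
From mathcomp Require Import measurable_realfun ring lra.

Set Implicit Arguments.
Unset Strict Implicit.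
Unset Printing Implicit Defensive.

Import Order.TTheory GRing.Theory Num.Theory.
Import numFieldTopology.Exports numFieldNormedType.Exports.

Local Open Scope classical_set_scope.
Local Open Scope ring_scope.

(** The uncertainty inequality of the group is applied to each slice of [f],
    and the resulting inequalities are integrated over (u,t).

    Put x = 1/(2p) and y = 1/(2q), and for a point u of the group let N(u) be
    the squared norm of the slice of [f] at u, A(u) its spatial moment and B(u)
    its frequency moment. The hypothesis reads N(u)^(x+y) <= C A(u)^x B(u)^y.
    Hoelder's inequality with the exponents (x+y)/x and (x+y)/y integrates it
    to (int N)^(x+y) <= C (int A)^x (int B)^y with the same constant
    ([integral_interpolate]).

    The integrals of N and A have the form int_u int_g F(g) Phi(g u^-1), where
    Phi is the square of the window and F is the square of [f], weighted or
    not. Substituting g -> g u for each u, exchanging the integrals and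
    substituting u -> g^-1 u gives (int F) (int Phi)
    ([integral_convolution]), because the measure is invariant under right and
    left translations. Hence int N is |psi|^2 |f|^2 and int A is |psi|^2 times
    the spatial moment of [f], and dividing by |psi|^(2x) gives the theorem.

    Two points need care. The function B need not be measurable, so that its
    integral is a lower integral and Hoelder's inequality does not apply to it;
    but the hypothesis bounds B from below by a measurable function of N and A
    for which the interpolation becomes an equality. And the function
    (g,u) |-> F(g) Phi(g u^-1) must be measurable for the product of the Borel
    sigma-algebras: on K this is where second countability enters, and on R^n
    the half-open boxes, which generate the Borel sets and also determine
    Lebesgue measure, reduce it to the coordinates. *)

(** * Borel structures and continuity *)

Lemma borel_continuous (T U : ptopologicalType) (f : T -> U) :
  continuous f -> measurable_fun [set: borel T] (f : borel T -> borel U).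
Proof.
move=> cf; apply: (@measurability _ _ (borel T) (borel U) _ _ (@open U)) => //.
move=> _ [B oB <-]; rewrite setTI; apply: sub_sigma_algebra.
by move/continuousP : cf; apply.
Qed.

Lemma bigcup_countable_measurable d (T : sigmaRingType d) (I : Type)
    (D : set I) (F : I -> set T) :
  countable D -> (forall i, D i -> measurable (F i)) ->
  measurable (\bigcup_(i in D) F i).
Proof.
move=> cD mF; rewrite bigcup_set_type.
apply: countable_bigcupT_measurable => [|i]; last exact/mF/set_valP.
by rewrite (eq_countable (card_setT _)).
Qed.

(** An open set is the union of the rectangles of basic open sets that it
    contains, and second countability makes this union countable. Without it
    the Borel sets of a product may be more than the product of the
    sigma-algebras. *)
Lemma open_measurable_prod (T U : ptopologicalType) (W : set (T * U)) :
  @second_countable T -> @second_countable U -> open W ->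
  measurable (W : set (borel T * borel U)).
Proof.
move=> [B cB [oB Bx]] [C cC [oC Cx]] oW.
pose I := [set AB : set T * set U | [/\ B AB.1, C AB.2 & AB.1 `*` AB.2 `<=` W]].
have -> : W = \bigcup_(AB in I) (AB.1 `*` AB.2).
  apply/seteqP; split=> [[x y] Wxy|p [AB [_ _ sub]] /sub//].
  have [[P Q] /= [nP nQ] PQW] : nbhs (x, y) W by exact: open_nbhs_nbhs.
  have [A [BA Ax] AP] := Bx x P nP.
  have [A' [CA A'y] AQ] := Cx y Q nQ.
  exists (A, A') => //=; split => // -[u v] [/= Au Av]; apply: PQW.
  by split; [exact: AP|exact: AQ].
apply: bigcup_countable_measurable => [|[A A'] [/= BA CA _]].
  by apply: sub_countable (countableX cB cC); apply: subset_card_le => p [].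
by apply: measurableX; apply: sub_sigma_algebra; [exact: oB|exact: oC].
Qed.

Lemma borel_continuous2 (T U V : ptopologicalType) (f : T * U -> V) :
  @second_countable T -> @second_countable U -> continuous f ->
  measurable_fun [set: borel T * borel U] (f : borel T * borel U -> borel V).
Proof.
move=> cT cU cf.
apply: (@measurability _ _ (borel T * borel U)%type (borel V) _ _
  (@open V)) => //.
move=> _ [B oB <-]; rewrite setTI; apply: open_measurable_prod => //.
by move/continuousP : cf; apply.
Qed.

(** * Product measures and invariance *)

Section ProductMeasure.
Context d1 d2 (T1 : measurableType d1) (T2 : measurableType d2) (R : realType).
Variable m1 : {sigma_finite_measure set T1 -> \bar R}.
Variable m2 : {sigma_finite_measure set T2 -> \bar R}.

Definition prod_measure : set (T1 * T2) -> \bar R := (m1 \x m2)%E.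

(** The structure that the theorem of Tonelli on the square of the product
    asks for. *)
Lemma prod_measure_sigma_finite : sigma_finite [set: T1 * T2] prod_measure.
Proof.
have /sigma_finiteP[F [TF ndF Ffin]] := sigma_finiteT m1.
have /sigma_finiteP[G [TG ndG Gfin]] := sigma_finiteT m2.
exists (fun k => F k `*` G k) => [|k].
  apply/seteqP; split=> // -[x y] _.
  have [i _ Fix] : (\bigcup_k F k) x by rewrite -TF.
  have [j _ Gjy] : (\bigcup_k G k) y by rewrite -TG.
  exists (maxn i j) => //; split => /=.
  - by have /subsetPset := ndF _ _ (leq_maxl i j); exact.
  - by have /subsetPset := ndG _ _ (leq_maxr i j); exact.
have [mF Foo] := Ffin k; have [mG Goo] := Gfin k.
split; first exact: measurableX.
by rewrite /prod_measure product_measure1E// lte_mul_pinfty// ge0_fin_numE.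
Qed.

HB.instance Definition _ := Measure.copy prod_measure (m1 \x m2)%E.
HB.instance Definition _ :=
  Measure_isSigmaFinite.Build _ _ _ prod_measure prod_measure_sigma_finite.

End ProductMeasure.

Section Invariance.
Local Open Scope ereal_scope.

Definition preserves d (T : measurableType d) (R : realType)
    (mu : set T -> \bar R) (phi : T -> T) :=
  measurable_fun [set: T] phi /\
  forall A, measurable A -> mu (phi @^-1` A) = mu A.

(** Change of variables: the image of [mu] under [phi] is [mu] itself. *)
Lemma preserves_integral d (T : measurableType d) (R : realType)
    (mu : {measure set T -> \bar R}) (phi : T -> T) (f : T -> \bar R) :
  preserves mu phi -> measurable_fun [set: T] f -> (forall x, 0 <= f x) ->
  \int[mu]_x f (phi x) = \int[mu]_x f x.
Proof.
move=> [mphi muphi] mf f0.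
rewrite -[LHS](ge0_integral_pushforward mphi mu measurableT mf)//.
by apply: eq_measure_integral => A mA _; exact: muphi.
Qed.

(** The image of the product measure takes the right values on rectangles, and
    these determine it. *)
Lemma preserves_prod d1 d2 (T1 : measurableType d1) (T2 : measurableType d2)
    (R : realType) (m1 : {sigma_finite_measure set T1 -> \bar R})
    (m2 : {sigma_finite_measure set T2 -> \bar R}) phi1 phi2 :
  preserves m1 phi1 -> preserves m2 phi2 ->
  preserves (m1 \x m2) (fun p => (phi1 p.1, phi2 p.2)).
Proof.
move=> [mphi1 inv1] [mphi2 inv2].
have mphi : measurable_fun [set: T1 * T2] (fun p => (phi1 p.1, phi2 p.2)).
  by apply: measurable_fun_pair; exact: measurableT_comp.
split=> // A mA; apply/esym.
apply: (product_measure_unique (m' := pushforward (m1 \x m2)%E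
  (fun p => (phi1 p.1, phi2 p.2)))) => // A1 A2 mA1 mA2.
rewrite /pushforward -inv1// -inv2// -product_measure1E//.
- by rewrite -[X in measurable X]setTI; exact: mphi1.
- by rewrite -[X in measurable X]setTI; exact: mphi2.
Qed.

(** Right invariance replaces [x] by [x u] for each [u], so that the argument of
    [Phi] becomes [x]; after an exchange of the integrals, left invariance
    evaluates the integral of F(x u) over [u]. *)
Lemma integral_convolution d (T : measurableType d) (R : realType)
    (mu : {sigma_finite_measure set T -> \bar R})
    (mul div : T -> T -> T) (F Phi : T -> \bar R) :
  measurable_fun [set: T * T] (fun p => mul p.1 p.2) ->
  measurable_fun [set: T * T] (fun p => div p.1 p.2) ->
  (forall x u, div (mul x u) u = x) ->
  (forall x, preserves mu (mul x)) -> (forall u, preserves mu (mul^~ u)) ->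
  measurable_fun [set: T] F -> measurable_fun [set: T] Phi ->
  (forall x, 0 <= F x) -> (forall x, 0 <= Phi x) ->
  \int[mu]_u \int[mu]_x (F x * Phi (div x u)) =
  \int[mu]_x F x * \int[mu]_x Phi x.
Proof.
move=> mmul mdiv mulK mull mulr mF mPhi F0 Phi0.
transitivity (\int[mu]_u \int[mu]_x (F (mul x u) * Phi x)).
  apply: eq_integral => u _.
  rewrite -(preserves_integral (mulr u)).
  - by apply: eq_integral => x _; rewrite mulK.
  - apply: emeasurable_funM => //; apply: measurableT_comp => //.
    exact: (measurableT_comp mdiv (pair2_measurable u)).
  - by move=> x; exact: mule_ge0.
rewrite (fubini_tonelli (fun p => F (mul p.2 p.1) * Phi p.2)); last 2 first.
- apply: emeasurable_funM; apply: measurableT_comp => //.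
  exact: (measurableT_comp mmul
    (measurable_fun_pair measurable_snd measurable_fst)).
- by move=> p; exact: mule_ge0.
rewrite -[RHS]ge0_integralZl //; last exact: integral_ge0.
apply: eq_integral => x _ /=; rewrite ge0_integralZr//.
- by rewrite (preserves_integral (mull x)).
- by apply: measurableT_comp => //; exact: (mull x).1.
Qed.

End Invariance.

(** * Haar measure *)

Section Haar.
Variables (R : realType) (K : topologicalGroupType).
Variable muK : {sigma_finite_measure set (borel K) -> \bar R}.

Lemma continuous_mull (k : K) : continuous (fun x : K => (k * x)%g).
Proof.
move=> x; apply: (@continuous2_cvg _ _ _ _ _ _ _ _ (fun u v : K => (u * v)%g))
  (cvg_cst k) cvg_id.
exact: (@mulg_continuous K (k, x)).
Qed.

Lemma continuous_mulr (k : K) : continuous (fun x : K => (x * k)%g).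
Proof.
move=> x; apply: (@continuous2_cvg _ _ _ _ _ _ _ _ (fun u v : K => (u * v)%g))
  cvg_id (cvg_cst k).
exact: (@mulg_continuous K (x, k)).
Qed.

Lemma continuous_divg : continuous (fun p : K * K => (p.1 * p.2^-1)%g).
Proof.
move=> [x y]; apply: (@continuous2_cvg _ _ _ _ _ _ _ _ (fun u v : K => (u * v)%g))
  cvg_fst _.
  exact: (@mulg_continuous K (x, y^-1)%g).
apply: (cvg_comp _ _ cvg_snd); exact: invg_continuous.
Qed.

(** The preimage of a set under a translation is its image under the inverse
    translation, to which the invariance in the definition applies. *)
Lemma left_haar_preserves k : left_haar muK ->
  preserves muK (fun x : borel K => (k * x)%g : borel K).
Proof.
move=> [lK _ _]; split; first exact: (borel_continuous (@continuous_mull k)).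
move=> A mA; rewrite -(lK (k^-1)%g _ mA); congr (muK _).
apply/seteqP; split=> [x Ax|_ [x Ax <-]] /=; last by rewrite mulVKg.
by exists (k * x)%g => //; rewrite mulKg.
Qed.

Lemma unimodular_preserves k : left_haar muK -> unimodular R K ->
  preserves muK (fun x : borel K => (x * k)%g : borel K).
Proof.
move=> lK /(_ muK lK) rK; split.
  exact: (borel_continuous (@continuous_mulr k)).
move=> A mA; rewrite -(rK (k^-1)%g _ mA); congr (muK _).
apply/seteqP; split=> [x Ax|_ [x Ax <-]] /=; last by rewrite mulgVK.
by exists (x * k)%g => //; rewrite mulgK.
Qed.

End Haar.

(** * Lebesgue measure on R^n *)

Section Euclidean.
Variables (R : realType) (n : nat).
Local Notation Rn := 'rV[R]_n.

(** Half-open boxes are stable under intersection, so that measures which agree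
    on them agree on the sigma-algebra that they generate. *)
Definition box (u v : Rn) : set Rn :=
  [set x | forall i, u 0 i < x 0 i <= v 0 i].

Lemma measurable_coord i :
  measurable_fun [set: borel Rn] ((fun x : Rn => x 0 i) : borel Rn -> R).
Proof.
apply: (@measurability _ _ (borel Rn) R _ _ _ (RGenOpens.measurableE R)).
move=> _ [_ [y [z ->]] <-]; rewrite setTI; apply: sub_sigma_algebra.
apply: open_comp => [x _|]; last exact: itv_open.
exact: coord_continuous.
Qed.

Lemma boxE u v : box u v = \bigcap_(i in [set: 'I_n])
  ((fun x : Rn => x 0 i) @^-1` `]u 0 i, v 0 i]%classic).
Proof.
apply/seteqP; split=> [x uxv i _|x uxv i]; first by rewrite /= in_itv/= uxv.
by have := uxv i I; rewrite /= in_itv.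
Qed.

Lemma measurable_box u v : measurable (box u v : set (borel Rn)).
Proof.
rewrite boxE; apply: fin_bigcap_measurable => // i _.
by rewrite -[X in measurable X]setTI; exact: measurable_coord.
Qed.

(** A point of an open set lies in a box with rational corners that is contained
    in the ball given by the sup norm; rational corners keep the union
    countable. *)
Lemma open_bigcup_box (U : set Rn) : open U ->
  U = \bigcup_(p in [set p : 'rV[rat]_n * 'rV[rat]_n |
       box (map_mx ratr p.1) (map_mx ratr p.2) `<=` U])
       box (map_mx ratr p.1) (map_mx ratr p.2).
Proof.
move=> oU; apply/seteqP; split => [x Ux|x [p sub] /sub//].
have /nbhs_ballP[e /= e0 xeU] : nbhs x U by exact: open_nbhs_nbhs.
have ratlt (a b : R) : a < b -> {q : rat | a < ratr q < b}.
  by move=> /rat_in_itvoo aqb; apply: cid; have [q] := aqb; exists q.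
have xe i : x 0 i - e < x 0 i by rewrite ltrBlDr ltrDl.
have ex i : x 0 i < x 0 i + e by rewrite ltrDl.
exists (\row_i sval (ratlt _ _ (xe i)), \row_i sval (ratlt _ _ (ex i))).
  move=> y /= yb; apply: xeU; split=> // i j; rewrite ord1 /ball/= ltr_norml.
  have /= := yb j; rewrite !mxE.
  have /andP[] := svalP (ratlt _ _ (xe j)).
  have /andP[] := svalP (ratlt _ _ (ex j)).
  set q := sval _; set r := sval _; lra.
move=> i /=; rewrite !mxE.
have /andP[_ ->]/= := svalP (ratlt _ _ (xe i)).
by have /andP[/ltW -> _] := svalP (ratlt _ _ (ex i)).
Qed.

Lemma borel_rVE :
  @measurable _ (borel Rn) = <<s [set box p.1 p.2 | p in [set: Rn * Rn]] >>.
Proof.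
apply/seteqP; split.
  apply: smallest_sub; first exact: smallest_sigma_algebra.
  move=> U /open_bigcup_box ->.
  apply: (@bigcup_countable_measurable _ (g_sigma_algebraType _)) => // p _.
  apply: sub_sigma_algebra.
  by exists (map_mx ratr p.1, map_mx ratr p.2).
apply: smallest_sub; first exact: sigma_algebra_measurable.
by move=> _ [p _ <-]; exact: measurable_box.
Qed.

(** Since boxes generate the Borel sets and are cut out by conditions on the
    coordinates, measurability is checked on the coordinates. *)
Lemma measurable_fun_rV d (T : measurableType d) (f : T -> Rn) :
  (forall i, measurable_fun [set: T] (fun t => f t 0 i)) ->
  measurable_fun [set: T] (f : T -> borel Rn).
Proof.
move=> mf; apply: (@measurability _ _ T (borel Rn) _ _ _ borel_rVE).
move=> _ [_ [p _ <-] <-]; rewrite setTI boxE preimage_bigcap.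
apply: fin_bigcap_measurable => // i _.
by rewrite -[X in measurable X]setTI; exact: mf.
Qed.

Lemma measurable_euclid_norm :
  measurable_fun [set: borel Rn] (@euclid_norm R n : borel Rn -> R).
Proof.
apply: (measurableT_comp (continuous_measurable_fun (@sqrt_continuous R))).
apply: measurable_sum => i.
by apply: measurable_funX; exact: measurable_coord.
Qed.

Lemma measurable_subrV :
  measurable_fun [set: borel Rn * borel Rn]
    ((fun p => (p.1 : Rn) - p.2) : borel Rn * borel Rn -> borel Rn).
Proof.
apply: measurable_fun_rV => i; under eq_fun do rewrite !mxE.
apply: measurable_funB.
- exact: (measurableT_comp (measurable_coord i) measurable_fst).
- exact: (measurableT_comp (measurable_coord i) measurable_snd).
Qed.

Lemma measurable_addrV :
  measurable_fun [set: borel Rn * borel Rn]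
    ((fun p => (p.1 : Rn) + p.2) : borel Rn * borel Rn -> borel Rn).
Proof.
apply: measurable_fun_rV => i; under eq_fun do rewrite !mxE.
apply: measurable_funD.
- exact: (measurableT_comp (measurable_coord i) measurable_fst).
- exact: (measurableT_comp (measurable_coord i) measurable_snd).
Qed.

Lemma box0 (u v : Rn) : ~ (forall i, u 0 i <= v 0 i) -> box u v = set0.
Proof.
move=> uv; apply/seteqP; split=> // x uxv; apply: uv => i.
by have /andP[/ltW ux xv] := uxv i; exact: le_trans xv.
Qed.

Lemma box_setI (u v u' v' : Rn) : box u v `&` box u' v' =
  box (\row_i Num.max (u 0 i) (u' 0 i)) (\row_i Num.min (v 0 i) (v' 0 i)).
Proof.
apply/seteqP; split=> [x [b b'] i|x b].
  by rewrite !mxE gt_max le_min andbACA b b'.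
by split=> i; have := b i; rewrite !mxE gt_max le_min andbACA => /andP[].
Qed.

Lemma preimage_box_add (t u v : Rn) :
  (fun x => x + t) @^-1` box u v = box (u - t) (v - t).
Proof.
by apply/seteqP; split=> x /= b i; move: (b i); rewrite !mxE ltrBlDr lerBrDr.
Qed.

(** Boxes with corners in the wrong order are empty, but [lebesgue_Rn] speaks
    only of ordered corners. *)
Lemma lebesgue_box_add (lam : {measure set (borel Rn) -> \bar R}) (t u v : Rn) :
  lebesgue_Rn lam -> lam (box (u + t) (v + t)) = lam (box u v).
Proof.
move=> lamE; have [uv|uv] := pselect (forall i, u 0 i <= v 0 i).
  rewrite (lamE u v uv) (lamE (u + t) (v + t)); last first.
    by move=> i; rewrite !mxE lerD2r.
  by congr (_ %:E); apply: eq_bigr => i _; rewrite !mxE opprD addrACA subrr addr0.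
rewrite !box0// => utv; apply: uv => i.
by have := utv i; rewrite !mxE lerD2r.
Qed.

(** A measure that is finite on the boxes of a cover is determined by its values
    on the boxes, and these do not change under translation. *)
Lemma lebesgue_preserves_add (lam : {measure set (borel Rn) -> \bar R}) (t : Rn) :
  lebesgue_Rn lam -> preserves lam (fun x : borel Rn => (x : Rn) + t : borel Rn).
Proof.
move=> lamE; have madd : measurable_fun [set: borel Rn]
    (fun x : borel Rn => (x : Rn) + t : borel Rn).
  exact: (measurableT_comp measurable_addrV (pair2_measurable (t : borel Rn))).
split=> // A mA; apply/esym.
pose g k : set (borel Rn) := box (const_mx (- k%:R)) (const_mx k%:R).
refine (@measure_unique _ R (borel Rn) _ g borel_rVE _ _ _ lam
  (pushforward lam (fun x : borel Rn => (x : Rn) + t : borel Rn)) _ _ A mA) => //.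
- by move=> _ _ [p _ <-] [q _ <-]; rewrite box_setI; eexists (_, _).
- by move=> k; eexists (_, _).
- apply/seteqP; split=> // x _.
  exists (Num.truncn (\sum_i `|x 0 i|)).+1 => // i; rewrite !mxE.
  have xi : `|x 0 i| < (Num.truncn (\sum_i `|x 0 i|)).+1%:R.
    apply: le_lt_trans (truncnS_gt _); rewrite (bigD1 i)//= lerDl.
    exact: sumr_ge0.
  by move: xi; rewrite ltr_norml => /andP[-> /ltW].
- move=> _ [[u v] _ <-] /=; rewrite /pushforward preimage_box_add.
  by rewrite lebesgue_box_add.
- by move=> k; rewrite /g lamE ?ltry// => i; rewrite !mxE; have := ler0n R k; lra.
Unshelve. exact: madd.
Qed.

End Euclidean.

(** * Interpolation between integrals *)

Section Hoelder.
Local Open Scope ereal_scope.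
Context d (T : measurableType d) (R : realType).
Variable mu : {measure set T -> \bar R}.

(** The integral of a nonnegative function is the supremum of the integrals of
    the simple functions below it, so it is monotone for all functions,
    measurable or not. *)
Lemma ge0_le_lower_integral (f g : T -> \bar R) :
  (forall t, 0 <= f t) -> (forall t, f t <= g t) ->
  \int[mu]_t f t <= \int[mu]_t g t.
Proof.
move=> f0 fg; have g0 t : 0 <= g t by exact: le_trans (fg t).
rewrite !ge0_integralTE//; apply: ereal_sup_le => _ [h /= hf <-].
by exists h => //= t; exact: le_trans (fg t).
Qed.

Lemma ge0_le_poweR (z : R) (u v : \bar R) :
  (0 <= z)%R -> 0 <= u -> u <= v -> u `^ z <= v `^ z.
Proof.
move=> z0 u0 uv; apply: (gt0_ler_poweR z0) => //; rewrite in_itv/= leey andbT//.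
exact: le_trans uv.
Qed.

(** The value [b] in the inner brackets solves n^(x+y) = C a^x b^y. *)
Lemma powR_interpolate (C n a x y : R) : (0 < C)%R -> (0 <= n)%R -> (0 < a)%R ->
  (0 < x)%R -> (0 < y)%R ->
  n = (C `^ (x + y)^-1 * (a `^ (x / (x + y)) *
       ((C^-1 * n `^ (x + y) * (a `^ x)^-1) `^ y^-1) `^ (y / (x + y))))%R.
Proof.
move=> C0 n0 a0 x0 y0; have xy0 : (0 < x + y)%R by exact: addr_gt0.
have xyN0 : (x + y)%R != 0%R by rewrite gt_eqF.
have aV : (((a `^ x)^-1) `^ (x + y)^-1 = (a `^ (x / (x + y)))^-1)%R.
  by rewrite -!powRN -powRrM mulNr.
have CV : ((C^-1) `^ (x + y)^-1 = (C `^ (x + y)^-1)^-1)%R.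
  by rewrite -(powR_inv1 (ltW C0)) -powRrM mulN1r powRN.
have nV : ((n `^ (x + y)) `^ (x + y)^-1 = n)%R.
  by rewrite -powRrM mulfV// powRr1.
have C'0 : (0 <= C^-1)%R by rewrite invr_ge0 ltW.
have nxy0 : (0 <= n `^ (x + y))%R by exact: powR_ge0.
have ax0 : (0 <= (a `^ x)^-1)%R by rewrite invr_ge0 powR_ge0.
rewrite -powRrM mulKf ?gt_eqF// powRM//; last exact: mulr_ge0.
rewrite powRM// aV CV nV.
by field; rewrite !gt_eqF ?powR_gt0.
Qed.

(** Hoelder's inequality for the functions a^x and b^y and the conjugate
    exponents 1/x and 1/y. *)
Lemma hoelder_powR (a b : T -> R) (x y : R) :
  measurable_fun [set: T] a -> measurable_fun [set: T] b ->
  (forall t, 0 <= a t)%R -> (forall t, 0 <= b t)%R ->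
  (0 < x)%R -> (0 < y)%R -> (x + y = 1)%R ->
  \int[mu]_t (a t `^ x * b t `^ y)%:E <=
  (\int[mu]_t (a t)%:E) `^ x * (\int[mu]_t (b t)%:E) `^ y.
Proof.
move=> ma mb a0 b0 x0 y0 xy1.
have mpow c z : measurable_fun [set: T] c ->
    measurable_fun [set: T] (fun t => c t `^ z)%R.
  by move=> mc; exact: (measurableT_comp (measurable_powR z)).
have normE (c : T -> R) z : (0 < z)%R -> (forall t, 0 <= c t)%R ->
    'N[mu]_(z^-1)%:E[EFin \o (fun t => c t `^ z)%R] = (\int[mu]_t (c t)%:E) `^ z.
  move=> z0 c0; rewrite unlock /= invrK; congr (_ `^ _).
  apply: eq_integral => t _ /=; rewrite ?poweR_EFin ger0_norm ?powR_ge0//.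
  by rewrite -powRrM divff ?gt_eqF// powRr1.
rewrite -!normE//.
apply: le_trans; last by apply: hoelder; rewrite ?invr_gt0 ?invrK//; exact: mpow.
rewrite Lnorm1 le_eqVlt; apply/orP; left; apply/eqP/eq_integral => t _ /=.
by rewrite ger0_norm// mulr_ge0// powR_ge0.
Qed.

(** Hoelder's inequality under an integral. It would follow at once for a
    measurable [B]. In general [B] is replaced by the smallest function [b] that
    the hypothesis allows, defined by N^(x+y) = C A^x b^y; it is measurable and
    lies below [B], which suffices because [B] occurs only through its
    integral.

    The equation has no finite solution where [A] vanishes and [N] does not. By
    the convention in [moment_product] the hypothesis then says that [B] is
    infinite, so this happens on a null set only, unless the integral of [B] is
    infinite and there is nothing to prove. *)
Lemma integral_interpolate (N A B : T -> \bar R) (C x y : R) :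
  (0 < C)%R -> (0 < x)%R -> (0 < y)%R ->
  measurable_fun [set: T] N -> measurable_fun [set: T] A ->
  (forall t, 0 <= N t) -> (forall t, 0 <= A t) -> (forall t, 0 <= B t) ->
  \int[mu]_t N t < +oo ->
  (forall t, N t < +oo -> N t `^ (x + y) <= moment_product C (A t) x (B t) y) ->
  (\int[mu]_t N t) `^ (x + y) <=
  moment_product C (\int[mu]_t A t) x (\int[mu]_t B t) y.
Proof.
move=> C0 x0 y0 mN mA N0 A0 B0 intN NAB.
have xy0 : (0 < x + y)%R by exact: addr_gt0.
rewrite /moment_product; case: ifPn; first by rewrite leey.
rewrite negb_or => /andP[]; rewrite -!ltey => intA intB.
pose n t := fine (N t); pose a t := fine (A t).
have n0 t : (0 <= n t)%R by exact: fine_ge0.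
have a0 t : (0 <= a t)%R by exact: fine_ge0.
(* By the conventions fine +oo = 0 and 0^-1 = 0, b vanishes where A is zero
   or infinite and where N is infinite. *)
pose b t := ((C^-1 * n t `^ (x + y) * (a t `^ x)^-1) `^ y^-1)%R.
have b0 t : (0 <= b t)%R by exact: powR_ge0.
have mn : measurable_fun [set: T] n by exact: measurableT_comp.
have ma : measurable_fun [set: T] a by exact: measurableT_comp.
have mb : measurable_fun [set: T] b.
  apply: (measurableT_comp (measurable_powR _)).
  apply: measurable_funM.
    apply: measurable_funM => //.
    exact: (measurableT_comp (measurable_powR _)).
  under eq_fun do rewrite -powRN.
  exact: (measurableT_comp (measurable_powR _)).
have B_top t : A t = 0 -> 0 < N t < +oo -> B t = +oo.
  move=> At0 /andP[Nt0 Ntoo]; apply/eqP/negPn/negP => Btoo.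
  have := NAB t Ntoo; rewrite /moment_product At0 (negbTE Btoo).
  rewrite poweR0r ?(gt_eqF x0)// mule0 mul0e /= leNgt.
  by rewrite poweR_gt0.
have fineN0 (u : \bar R) : fine u != 0%R -> u = (fine u)%:E.
  by case: u => //=; rewrite eqxx.
have leb t : (b t)%:E <= B t.
  have [/eqP at0|at0] := boolP (a t == 0%R).
    by rewrite /b at0 powR0 ?gt_eqF// invr0 mulr0 powR0 ?invr_eq0 ?gt_eqF.
  have [/eqP nt0|nt0] := boolP (n t == 0%R).
    by rewrite /b nt0 powR0 ?gt_eqF// mulr0 mul0r powR0 ?invr_eq0 ?gt_eqF.
  have Atfin : A t = (a t)%:E by exact: fineN0.
  have Ntfin : N t = (n t)%:E by exact: fineN0.
  have := NAB t; rewrite Atfin Ntfin ltry => /(_ isT).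
  rewrite /moment_product; move: (B0 t).
  case: (B t) => [r|_ _|//] /=; last exact: leey.
  rewrite lee_fin => r0.
  rewrite -!EFinM !lee_fin => nle.
  have at_gt0 : (0 < a t)%R by rewrite lt0r at0 a0.
  rewrite -[leRHS]powRr1// -(@mulfV _ y) ?gt_eqF// powRrM /b.
  apply: ge0_ler_powR; rewrite ?nnegrE ?invr_ge0 ?(ltW y0) ?powR_ge0//.
    by rewrite !mulr_ge0 ?invr_ge0 ?powR_ge0 ?ltW.
  by rewrite ler_pdivrMr ?powR_gt0// mulrC ler_pdivrMr// mulrC mulrA mulrAC.
(* The exceptional set of the equation n^(x+y) = C a^x b^y. *)
pose Z := [set t | A t = 0] `&` [set t | 0 < N t < +oo].
have mZ : measurable Z.
  apply: measurableI.
    rewrite -[X in measurable X]setTI.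
    exact: (mA measurableT _ (emeasurable_set1 0)).
  rewrite [X in measurable X](_ : _ =
      (setT `&` [set t | 0 < N t]) `&` (setT `&` [set t | N t < +oo])).
    by apply: measurableI; exact: measurable_lte.
  by rewrite !setTI; apply/seteqP; split=> t /=; [move/andP|move=> h; apply/andP].
have nullZ : {ae mu, forall t, ~ Z t}.
  exists Z; split=> // [|t /= /contrapT//].
  apply/eqP/negPn/negP => Z0; move: intB; rewrite ltNge => /negP; apply.
  have <- : \int[mu]_(t in Z) +oo = +oo.
    by rewrite (integral_cst _ mZ +oo) gt0_mulye// lt0e Z0 measure_ge0.
  rewrite integral_mkcond; apply: ge0_le_lower_integral => t.
    by rewrite patchE; case: ifP.
  rewrite patchE; case: ifP => [|_]; last exact: B0.
  by rewrite inE => -[At0 Nt0]; rewrite (B_top t).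
have mab : measurable_fun [set: T]
    (fun t => (a t `^ (x / (x + y)) * b t `^ (y / (x + y)))%:E).
  apply/measurable_EFinP.
  by apply: measurable_funM; exact: (measurableT_comp (measurable_powR _)).
have intNE : \int[mu]_t N t <=
    (C `^ (x + y)^-1)%:E *
    \int[mu]_t (a t `^ (x / (x + y)) * b t `^ (y / (x + y)))%:E.
  rewrite -ge0_integralZl; last first.
  - by rewrite lee_fin powR_ge0.
  - by move=> t _; rewrite lee_fin mulr_ge0// powR_ge0.
  - exact: mab.
  - by [].
  apply: ae_ge0_le_integral => //.
  - by move=> t _; rewrite mule_ge0// lee_fin ?mulr_ge0 ?powR_ge0.
  - exact: measurable_funeM.
  have Nfin : {ae mu, forall t, [set: T] t -> N t \is a fin_num}.
    apply: integrable_ae => //; apply/integrableP; split => //.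
    by under eq_integral do rewrite gee0_abs//.
  have Afin : {ae mu, forall t, [set: T] t -> A t \is a fin_num}.
    apply: integrable_ae => //; apply/integrableP; split => //.
    by under eq_integral do rewrite gee0_abs//.
  apply: filterS3 Nfin Afin nullZ => t /(_ I) Ntfin /(_ I) Atfin nZt _.
  have [/eqP nt0|nt0] := boolP (n t == 0%R).
    by rewrite -(fineK Ntfin) -/(n t) nt0 mule_ge0// lee_fin ?mulr_ge0 ?powR_ge0.
  have at_gt0 : (0 < a t)%R.
    rewrite lt0r a0 andbT; apply: contra_notN nZt => /eqP at0; split=> /=.
      by rewrite -(fineK Atfin) -/(a t) at0.
    by rewrite -(fineK Ntfin) -/(n t) ltry lte_fin lt0r nt0 n0.
  by rewrite -(fineK Ntfin) -EFinM lee_fin -powR_interpolate.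
have abE : \int[mu]_t (a t `^ (x / (x + y)) * b t `^ (y / (x + y)))%:E <=
    (\int[mu]_t A t) `^ (x / (x + y)) * (\int[mu]_t B t) `^ (y / (x + y)).
  apply: le_trans (hoelder_powR ma mb _ _ _ _ _) _; rewrite ?divr_gt0//.
    by rewrite -mulrDl divff ?gt_eqF.
  have lea t : (a t)%:E <= A t.
    by rewrite /a; move: (A0 t); case: (A t) => //= _; exact: leey.
  have mono (f : T -> R) (g : T -> \bar R) z : (0 < z)%R ->
      (forall t, 0 <= f t)%R -> (forall t, (f t)%:E <= g t) ->
      (\int[mu]_t (f t)%:E) `^ z <= (\int[mu]_t g t) `^ z.
    move=> z0 f0 fg.
    have f0' t : 0 <= (f t)%:E by rewrite lee_fin.
    apply: (ge0_le_poweR (ltW z0)); first exact: integral_ge0.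
    exact: ge0_le_lower_integral.
  by apply: lee_pmul; rewrite ?poweR_ge0//; apply: mono; rewrite ?divr_gt0.
have xyN0 : (x + y != 0)%R by rewrite gt_eqF.
have intN0 : 0 <= \int[mu]_t N t by exact: integral_ge0.
have Cz0 : 0 <= (C `^ (x + y)^-1)%:E by rewrite lee_fin powR_ge0.
have le_int := le_trans intNE (lee_wpmul2l Cz0 abE).
apply: le_trans (ge0_le_poweR (ltW xy0) intN0 le_int) _.
rewrite !poweRM ?mule_ge0 ?poweR_ge0// poweR_EFin -powRrM mulVf//.
by rewrite (powRr1 (ltW C0)) -!poweRrM !divfK// muleA.
Qed.

End Hoelder.

(** * Slices of the Gabor transform *)

Local Notation cnorm := ComplexField.Normc.normc.

Lemma normcE (R : realType) (z : R[i]) :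
  cnorm z = Num.sqrt (complex.Re z ^+ 2 + complex.Im z ^+ 2).
Proof. by case: z. Qed.

Lemma normc_ge0 (R : realType) (z : R[i]) : 0 <= cnorm z.
Proof. by rewrite normcE sqrtr_ge0. Qed.

Lemma normc_conj (R : realType) (z : R[i]) : cnorm z^* = cnorm z.
Proof. by case: z => x y; rewrite !normcE /= sqrrN. Qed.

Lemma Re_mul_conj (R : realType) (z w : R[i]) :
  complex.Re (z * w^*) =
  complex.Re z * complex.Re w + complex.Im z * complex.Im w.
Proof. by case: z w => [a b] [c d] /=; rewrite mulrN opprK. Qed.

Lemma Im_mul_conj (R : realType) (z w : R[i]) :
  complex.Im (z * w^*) =
  complex.Im z * complex.Re w - complex.Re z * complex.Im w.
Proof. by case: z w => [a b] [c d] /=; ring. Qed.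

Section L2.
Variables (R : realType) (n : nat) (K : topologicalGroupType).
Local Notation Rn := 'rV[R]_n.
Variables (muK : {sigma_finite_measure set (borel K) -> \bar R})
          (lam : {sigma_finite_measure set (borel Rn) -> \bar R}).
Local Notation muG := (muK \x lam)%E.
Local Notation G := (borel K * borel Rn)%type.
Local Open Scope ereal_scope.

Lemma L_norm2E (h : K * Rn -> R[i]) :
  L_norm muK lam 2 h = (\int[muG]_g ((cnorm (h g) ^+ 2)%R)%:E) `^ 2^-1.
Proof.
rewrite /L_norm unlock /=; congr (_ `^ _); apply: eq_integral => g _ /=.
by rewrite (ger0_norm (normc_ge0 _)) powR_mulrn ?normc_ge0.
Qed.

Lemma measurable_normc2 p (h : K * Rn -> R[i]) : in_L muK lam p h ->
  measurable_fun [set: G] (fun g : G => ((cnorm (h g) ^+ 2)%R)%:E : \bar R).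
Proof.
move=> [mRe mIm _]; apply/measurable_EFinP; apply: measurable_funX.
under eq_fun do rewrite normcE.
apply: (measurableT_comp (continuous_measurable_fun (@sqrt_continuous R))).
by apply: measurable_funD; apply: measurable_funX.
Qed.

(** The operations of the direct product of K and R^n, not of the semidirect
    product: the slices translate the window in each factor separately. *)
Definition gmul (g h : G) : G := ((g.1 * h.1 : K)%g, (g.2 + h.2 : Rn)%R).
Definition gdiv (g h : G) : G := ((g.1 * h.1^-1 : K)%g, (g.2 - h.2 : Rn)%R).

Hypothesis cK : @second_countable K.

Lemma measurable_gmul : measurable_fun [set: G * G] (fun p => gmul p.1 p.2).
Proof.
apply: measurable_fun_pair.
- exact: (measurableT_comp (borel_continuous2 cK cK (@mulg_continuous K))
    (measurable_fun_pair (measurableT_comp measurable_fst measurable_fst)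
      (measurableT_comp measurable_fst measurable_snd))).
- exact: (measurableT_comp (@measurable_addrV R n)
    (measurable_fun_pair (measurableT_comp measurable_snd measurable_fst)
      (measurableT_comp measurable_snd measurable_snd))).
Qed.

Lemma measurable_gdiv : measurable_fun [set: G * G] (fun p => gdiv p.1 p.2).
Proof.
apply: measurable_fun_pair.
- exact: (measurableT_comp (borel_continuous2 cK cK (@continuous_divg K))
    (measurable_fun_pair (measurableT_comp measurable_fst measurable_fst)
      (measurableT_comp measurable_fst measurable_snd))).
- exact: (measurableT_comp (@measurable_subrV R n)
    (measurable_fun_pair (measurableT_comp measurable_snd measurable_fst)
      (measurableT_comp measurable_snd measurable_snd))).
Qed.

Lemma gmulK x u : gdiv (gmul x u) u = x.
Proof. by case: x => k x; rewrite /gdiv /gmul /= mulgK addrK. Qed.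

(** Not every slice is square integrable; almost all are, as the integral of
    their squared norms is finite. *)
Lemma in_L2_slice (psi f : K * Rn -> R[i]) (ut : K * Rn) :
  in_L muK lam 2 psi -> in_L muK lam 2 f ->
  \int[muG]_g ((cnorm (gabor_slice psi f ut g) ^+ 2)%R)%:E < +oo ->
  in_L muK lam 2 (gabor_slice psi f ut).
Proof.
move=> [mRep mImp _] [mRef mImf _] fin.
have mdiv : measurable_fun [set: G] (gdiv^~ (ut : G)).
  exact: (measurableT_comp measurable_gdiv (pair2_measurable (ut : G))).
have mRe := measurableT_comp mRep mdiv; have mIm := measurableT_comp mImp mdiv.
split.
- under eq_fun do rewrite /gabor_slice Re_mul_conj.
  by apply: measurable_funD; apply: measurable_funM.
- under eq_fun do rewrite /gabor_slice Im_mul_conj.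
  by apply: measurable_funB; apply: measurable_funM.
- by rewrite L_norm2E poweR_lty.
Qed.

Lemma slice_normc2 (psi f : K * Rn -> R[i]) (ut g : K * Rn) :
  (cnorm (gabor_slice psi f ut g) ^+ 2 =
   cnorm (f g) ^+ 2 * cnorm (psi (gdiv g ut)) ^+ 2)%R.
Proof. by rewrite /gabor_slice ComplexField.Normc.normcM normc_conj exprMn. Qed.

Lemma measurable_convolution (F Phi : G -> \bar R) :
  measurable_fun [set: G] F -> measurable_fun [set: G] Phi ->
  (forall x, 0 <= F x) -> (forall x, 0 <= Phi x) ->
  measurable_fun [set: G] (fun u => \int[muG]_x (F x * Phi (gdiv x u))).
Proof.
move=> mF mPhi F0 Phi0.
pose f p := F p.1 * Phi (gdiv p.1 p.2).
have mf : measurable_fun [set: G * G] f.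
  apply: emeasurable_funM; first exact: measurableT_comp.
  exact: (measurableT_comp mPhi measurable_gdiv).
have f0 p : 0 <= f p by exact: mule_ge0.
exact: (measurable_fun_fubini_tonelli_G (m1 := prod_measure muK lam) f mf f0).
Qed.

Hypotheses (lK : left_haar muK) (uK : unimodular R K) (lamE : lebesgue_Rn lam).

Lemma preserves_gmull x : preserves muG (gmul x).
Proof.
apply: (preserves_prod (left_haar_preserves x.1 lK)
  (_ : preserves lam (fun y : borel Rn => (x.2 : Rn) + y : borel Rn)%R)).
rewrite (_ : (fun _ => _) = (fun y : borel Rn => (y : Rn) + x.2 : borel Rn)%R).
  exact: lebesgue_preserves_add.
by apply/funext => y; rewrite addrC.
Qed.

Lemma preserves_gmulr u : preserves muG (gmul^~ u).
Proof.
exact: (preserves_prod (unimodular_preserves u.1 lK uK)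
  (lebesgue_preserves_add u.2 lamE)).
Qed.

(** With the square of [f] for [F] this is the integral of the squared norms of
    the slices, and with its weighted square the integral of their spatial
    moments. *)
Lemma integral_slices (F : G -> \bar R) (psi : K * Rn -> R[i]) :
  measurable_fun [set: G] F -> (forall x, 0 <= F x) -> in_L muK lam 2 psi ->
  \int[muG]_u \int[muG]_x (F x * ((cnorm (psi (gdiv x u)) ^+ 2)%R)%:E) =
  \int[muG]_x F x * \int[muG]_x ((cnorm (psi x) ^+ 2)%R)%:E.
Proof.
move=> mF F0 psi2.
apply: (integral_convolution (mu := prod_measure muK lam) (mul := gmul)
  (F := F) (Phi := fun x : G => ((cnorm (psi x) ^+ 2)%R)%:E)) => //.
- exact: measurable_gmul.
- exact: measurable_gdiv.
- exact: gmulK.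
- exact: preserves_gmull.
- exact: preserves_gmulr.
- exact: (measurable_normc2 psi2).
- by move=> x; rewrite lee_fin exprn_ge0// normc_ge0.
Qed.

Lemma measurable_moment r (f : K * Rn -> R[i]) : in_L muK lam 2 f ->
  measurable_fun [set: G]
    (fun g : G => ((euclid_norm g.2 `^ r * cnorm (f g) ^+ 2)%R)%:E : \bar R).
Proof.
move=> f2; have /measurable_EFinP mf := measurable_normc2 f2.
apply/measurable_EFinP; apply: measurable_funM => //.
apply: (measurableT_comp (measurable_powR r)).
exact: (measurableT_comp (@measurable_euclid_norm R n) measurable_snd).
Qed.

Lemma frequency_moment_ge0 (a : automorphism_action R n K) (D : fourier_data a)
    r (F : operator_field D) : 0 <= frequency_moment D r F.
Proof.
apply: integral_ge0 => o _; apply: integral_ge0 => s _.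
rewrite mule_ge0 ?lee_fin ?powR_ge0//.
by apply: esum_ge0 => e _; rewrite lee_fin exprn_ge0// sqrtr_ge0.
Qed.

End L2.


(** * The uncertainty inequality *)

Lemma moment_product_mono (R : realType) (C C' : R) (I1 I2 : \bar R) (x y : R) :
  C <= C' -> (moment_product C I1 x I2 y <= moment_product C' I1 x I2 y)%E.
Proof.
move=> CC'; rewrite /moment_product; case: ifP => // _.
by rewrite !lee_wpmul2r ?poweR_ge0.
Qed.

Theorem theorem3p2 (R : realType) (n : nat) (K : topologicalGroupType)
  (muK : {sigma_finite_measure set (borel K) -> \bar R})
  (lam : {sigma_finite_measure set (borel 'rV[R]_n) -> \bar R})
  (a : automorphism_action R n K) (D : fourier_data a) :
  hausdorff_space K -> locally_compact [set: K] -> @second_countable K ->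
  left_haar muK -> unimodular R K -> type_I R K ->
  lebesgue_Rn lam ->
  plancherel muK lam D ->
  (exists C0 : R, forall h : K * 'rV[R]_n -> R[i], in_L muK lam 2 h ->
     forall p q : R, 1 <= p -> 1 <= q ->
     (L_norm muK lam 2 h `^ (p^-1 + q^-1) <=
      moment_product C0 (spatial_moment muK lam (2 * p) h) (2 * p)^-1
        (frequency_moment D (2 * q) (fourier muK lam D h)) (2 * q)^-1)%E) ->
  exists C : R, forall psi f : K * 'rV[R]_n -> R[i],
    in_L muK lam 2 psi -> L_norm muK lam 2 psi != 0%E -> in_L muK lam 2 f ->
    forall p q : R, 1 <= p -> 1 <= q ->
    (L_norm muK lam 2 psi `^ q^-1 * L_norm muK lam 2 f `^ (p^-1 + q^-1) <=
     moment_product C (spatial_moment muK lam (2 * p) f) (2 * p)^-1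
       (\int[muK \x lam]_ut
          frequency_moment D (2 * q) (gabor muK lam D psi f ut))
       (2 * q)^-1)%E.
Proof.
move=> _ _ cK lK uK _ lamE _ [C0 heisenberg].
(* The interpolation needs a positive constant. *)
exists (Num.max C0 1) => psi f psi2 psiN0 f2 p q p1 q1.
set C := Num.max C0 1; have C_gt0 : 0 < C by rewrite lt_max ltr01 orbT.
pose muG := (muK \x lam)%E.
pose sq (h : K * 'rV[R]_n -> R[i]) (g : borel K * borel 'rV[R]_n) : \bar R :=
  (cnorm (h g) ^+ 2)%:E.
have sq0 h g : (0 <= sq h g)%E by rewrite lee_fin exprn_ge0// normc_ge0.
have p0 : 0 < p by exact: lt_le_trans p1.
have q0 : 0 < q by exact: lt_le_trans q1.
set x := (2 * p)^-1; set y := (2 * q)^-1.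
have x0 : 0 < x by rewrite invr_gt0 mulr_gt0.
have y0 : 0 < y by rewrite invr_gt0 mulr_gt0.
have pE : p^-1 = 2 * x by rewrite /x invfM mulVKf.
have qE : q^-1 = 2 * y by rewrite /y invfM mulVKf.
rewrite !L_norm2E -!poweRrM pE qE -mulrDr !mulKf// -!/(sq _ _).
pose If := (\int[muG]_g sq f g)%E.
pose Ipsi := (\int[muG]_g sq psi g)%E.
pose M := spatial_moment muK lam (2 * p) f.
pose N ut := (\int[muG]_g sq (gabor_slice psi f ut) g)%E.
pose A ut := spatial_moment muK lam (2 * p) (gabor_slice psi f ut).
pose B ut := frequency_moment D (2 * q) (gabor muK lam D psi f ut).
have sq_fin h : in_L muK lam 2 h -> (\int[muG]_g sq h g < +oo)%E.
  by move=> [_ _]; rewrite L_norm2E => /lty_poweRy; apply; rewrite invr_eq0.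
have If_fin := sq_fin f f2; have Ipsi_fin := sq_fin psi psi2.
have Ipsi_gt0 : (0 < Ipsi)%E.
  rewrite lt0e integral_ge0 ?andbT; last by move=> g _; exact: sq0.
  apply: contra_neq psiN0 => Ipsi0.
  rewrite L_norm2E -[X in (X `^ _)%E]/Ipsi Ipsi0.
  by rewrite poweR0r ?invr_eq0.
have NE ut : N ut = (\int[muG]_g (sq f g * sq psi (gdiv g ut)))%E.
  by apply: eq_integral => g _; rewrite /sq slice_normc2 EFinM.
have AE ut : A ut = (\int[muG]_g ((euclid_norm g.2 `^ (2 * p) *
    cnorm (f g) ^+ 2)%:E * sq psi (gdiv g ut)))%E.
  by apply: eq_integral => g _; rewrite slice_normc2 mulrA EFinM.
have w0 r g : (0 <= (euclid_norm g.2 `^ r * cnorm (f g) ^+ 2)%:E :> \bar R)%E.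
  by rewrite lee_fin mulr_ge0 ?powR_ge0// exprn_ge0// normc_ge0.
have msq h : in_L muK lam 2 h ->
    measurable_fun [set: borel K * borel 'rV[R]_n] (sq h).
  by move=> h2; exact: (measurable_normc2 h2).
have mw := measurable_moment (2 * p) f2.
have intN : (\int[muG]_ut N ut = If * Ipsi)%E.
  under eq_integral do rewrite NE.
  exact: (integral_slices cK lK uK lamE (msq f f2) (sq0 f) psi2).
have intA : (\int[muG]_ut A ut = M * Ipsi)%E.
  under eq_integral do rewrite AE.
  exact: (integral_slices cK lK uK lamE mw (w0 _) psi2).
have mN : measurable_fun [set: borel K * borel 'rV[R]_n] N.
  rewrite (funext NE).
  exact: (measurable_convolution muK lam cK (msq f f2) (msq psi psi2)
    (sq0 f) (sq0 psi)).
have mA : measurable_fun [set: borel K * borel 'rV[R]_n] A.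
  rewrite (funext AE).
  exact: (measurable_convolution muK lam cK mw (msq psi psi2) (w0 _) (sq0 psi)).
have NAB ut : (N ut < +oo)%E ->
    (N ut `^ (x + y) <= moment_product C (A ut) x (B ut) y)%E.
  move=> /(in_L2_slice cK psi2 f2) /heisenberg /(_ p q p1 q1).
  rewrite L_norm2E -poweRrM pE qE -mulrDr mulKf// => /le_trans; apply.
  by apply: moment_product_mono; rewrite le_max lexx.
have := integral_interpolate (mu := muG) C_gt0 x0 y0 mN mA _ _ _ _ NAB.
rewrite intN intA.
have M0 : (0 <= M)%E by apply: integral_ge0 => g _; exact: w0.
have If0 : (0 <= If)%E by apply: integral_ge0 => g _; exact: sq0.
have -> : (If * Ipsi < +oo)%E.
  by rewrite lte_mul_pinfty// ge0_fin_numE.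
have N0 ut : (0 <= N ut)%E by apply: integral_ge0 => g _; exact: sq0.
have A0 ut : (0 <= A ut)%E.
  by rewrite AE; apply: integral_ge0 => g _; rewrite mule_ge0.
have B0 ut : (0 <= B ut)%E by exact: frequency_moment_ge0.
move=> /(_ N0 A0 B0 isT).
rewrite /moment_product -/M -/B.
have [|] := boolP ((M == +oo) || _)%E; first by rewrite leey.
rewrite negb_or => /andP[Mfin /negPf ->].
have Ipsi_num : Ipsi \is a fin_num by rewrite ge0_fin_numE//; exact: ltW.
have -> : (M * Ipsi == +oo)%E = false.
  by apply/negbTE; rewrite -ltey lte_mul_pinfty// ?ltey// ge0_fin_numE// ltey.
have Ipsi0 := ltW Ipsi_gt0.
rewrite !poweRM//= => le.
have Ipsix : (0 < Ipsi `^ x)%E by exact: poweR_gt0.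
(* The factor |psi|^(2x) from the moments of the slices cancels a part of
   |psi|^(2(x+y)) and leaves |psi|^(1/q). *)
rewrite -(lee_pmul2r _ Ipsix); last exact: fin_num_poweR.
rewrite -[X in (X `^ y)%E]/Ipsi -[X in (X `^ (x + y))%E]/If.
have xyN0 : x + y != 0 by rewrite gt_eqF ?addr_gt0.
have -> : (Ipsi `^ y * If `^ (x + y) * Ipsi `^ x =
           If `^ (x + y) * Ipsi `^ (x + y))%E.
  rewrite (poweRD (add_neq0_poweRD_def Ipsi xyN0)) muleAC muleC.
  by rewrite [X in (_ * X)%E]muleC.
by rewrite (muleAC _ _ (Ipsi `^ x)%E) -(muleA _ _ (Ipsi `^ x)%E).
Qed.
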